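(* Let $K$ be a compact line, and let $G: K \to \mathbb{R}$ be a nondecreasing, positive, and amenable function. Suppose that a continuous function $F: K \to \mathbb{R}$ is $G$-differentiable at every point of $K$, except possibly at $0_K$ and at a countable set of left-dense points. Let $f: K \to \mathbb{R}$ be any function such that $f(x) = \frac{dF}{dG}(x)$ at every point $x$ where $F$ is $G$-differentiable. Then $f$ is $G$-integrable, and \[\int_K f \, dG = F(1_K) - \left(F(0_K) - f(0_K) G(0_K)\right).\]
   Context: A compact line is a nonempty linearly ordered set $K$ whose order topology is compact; $0_K$ and $1_K$ denote its least and greatest elements (they exist), and intervals are written as usual, e.g. $(x,y]=\{z\in K: x<z\le y\}$. An open interval of $K$ is an interval that is an open subset of $K$. Integral. A partition of $K$ is $P=\{([x_{i-1},x_i],t_i):1\le i\le n\}$ with $0_K=x_0\le x_1\le\dots\le x_n=1_K$ in $K$ and $t_i\in[x_{i-1},x_i]$. A gauge on $K$ is a function $\delta$ assigning to each $x\in K$ an open interval $\delta(x)$ of $K$ with $x\in\delta(x)$. $P$ is $\delta$-fine, written $P\ll\delta$, if $(x_{i-1},x_i]\subset\delta(t_i)$ for all $i$. For $f,G:K\to\mathbb R$ set $S(f,G,P)=f(0_K)G(0_K)+\sum_{i=1}^n f(t_i)(G(x_i)-G(x_{i-1}))$. The function $f$ is $G$-integrable, with integral $\int_K f\,dG=A\in\mathbb R$, if for each $\varepsilon>0$ there is a gauge $\delta$ on $K$ such that $|S(f,G,P)-A|<\varepsilon$ for every $P\ll\delta$. Points. A point $x\in[0_K,1_K)$ is right-dense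 if every neighborhood of $x$ contains a point greater than $x$, otherwise right-isolated; $x\in(0_K,1_K]$ is left-dense if every neighborhood of $x$ contains a point less than $x$, otherwise left-isolated, in which case $x^-=\sup\{y\in K:y<x\}$ is its predecessor. By convention $0_K$ is left-isolated and $1_K$ is right-isolated. A function $h:K\to\mathbb R$ is right-continuous if at each $x\in[0_K,1_K)$, for every $\varepsilon>0$ there is a neighborhood $V$ of $x$ with $|h(y)-h(x)|<\varepsilon$ for $y\in V\cap[x,1_K]$. It is regulated at $x$ if the left-hand limit of $h$ at $x$ exists (in $\mathbb R$) when $x$ is left-dense, and the right-hand limit exists when $x$ is right-dense; it is regulated if this holds at every $x\in K$. $h$ is amenable if it is right-continuous and regulated. Define $L_h(0_K)=0$; $L_h(x)=\lim_{y\nearrow x}h(y)$ if $x\in(0_K,1_K]$ is left-dense (when the limit exists); $L_h(x)=h(x^-)$ if $x\in(0_K,1_K]$ is left-isolated. $G$-differentiability (for $G$ amenable and nondecreasing, $f:K\to\mathbb R$, $x\in K$). If $L_G(x)=G(x)$: $f$ is $G$-differentiable at $x$ if (in case $x$ is left-isolated, $f(x)=L_f(x)$, and) (i) $G$ is not constant on any neighborhood of $x$, and (ii) there is $D\in\mathbb R$ such that for every $\varepsilon>0$ there is a neighborhood $V$ of $x$ with $|f(y)-f(x)-D(G(y)-G(x))|\le\varepsilon|G(y)-G(x)|$ for all $y\in V$. If $L_G(x)\ne G(x)$: $f$ is $G$-differentiable at $x$ if (i) $f$ is regulated at $x$, and (ii) there is $D\in\mathbb R$ such that for every $\varepsilon>0$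 there is a neighborhood $V$ of $x$ with $|f(y)-L_f(x)-D(G(y)-L_G(x))|\le\varepsilon|G(y)-L_G(x)|$ for all $y\in V\cap[x,1_K]$. In both cases $D$ is unique and is denoted $\frac{df}{dG}(x)$. *)

(* Defs.v *)
From HB Require Import structures.
From mathcomp Require Import all_boot all_order all_algebra.
From mathcomp Require Import all_classical all_reals.
From mathcomp Require Import topology normedtype.

Set Implicit Arguments.
Unset Strict Implicit.
Unset Printing Implicit Defensive.

Import Order.TTheory GRing.Theory Num.Theory.
Import numFieldNormedType.Exports.

Local Open Scope classical_set_scope.
Local Open Scope ring_scope.

HB.mixin Record isCompactLine (K : Type) of Topological K := {
  line_nonempty : [set: K] !=set0 ;
  line_compact : compact [set: K]
}.

#[short(type="compactLineType")]
HB.structure Definition CompactLine d :=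
  { K of OrderTopological d K & isCompactLine K }.

Section Extremities.
Context {d : Order.disp_t}.

Lemma line_has_min (K : compactLineType d) : exists m : K, forall x, (m <= x)%O.
Proof.
apply: contrapT => nomin; have [x0 _] := @line_nonempty d K.
pose rays : set_system K := filter_from setT (fun a => `]-oo, a]%classic).
have rays_proper : ProperFilter rays.
  apply: filter_from_proper; last by move=> a _; exists a; rewrite /= in_itv/=.
  apply: filter_from_filter; first by exists x0.
  move=> a b _ _; exists (Order.min a b) => // z /=.
  by rewrite !in_itv/= le_min => /andP[].
have [p [_ clp]] := @line_compact d K rays rays_proper filterT.
have [a ap] : exists a : K, (a < p)%O.
  apply: contrapT => nox; apply: nomin; exists p => y.
  by rewrite leNgt; apply/negP => yx; apply: nox; exists y.
have /= [||z /=] := clp `]-oo, a]%classic `]a, +oo[%classic.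
- by exists a.
- by apply: open_nbhs_nbhs; split; [exact: rray_open | rewrite /= in_itv/= ap].
- by rewrite !in_itv/= andbT => -[/le_lt_trans h /h]; rewrite ltxx.
Qed.

Lemma line_has_max (K : compactLineType d) : exists m : K, forall x, (x <= m)%O.
Proof.
apply: contrapT => nomax; have [x0 _] := @line_nonempty d K.
pose rays : set_system K := filter_from setT (fun a => `[a, +oo[%classic).
have rays_proper : ProperFilter rays.
  apply: filter_from_proper; last by move=> a _; exists a; rewrite /= in_itv/= lexx.
  apply: filter_from_filter; first by exists x0.
  move=> a b _ _; exists (Order.max a b) => // z /=.
  by rewrite !in_itv/= !andbT ge_max => /andP[].
have [p [_ clp]] := @line_compact d K rays rays_proper filterT.
have [a ap] : exists a : K, (p < a)%O.
  apply: contrapT => nox; apply: nomax; exists p => y.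
  by rewrite leNgt; apply/negP => yx; apply: nox; exists y.
have /= [||z /=] := clp `[a, +oo[%classic `]-oo, a[%classic.
- by exists a.
- by apply: open_nbhs_nbhs; split; [exact: lray_open | rewrite /= in_itv/= ap].
- by rewrite !in_itv/= andbT => -[/le_lt_trans h /h]; rewrite ltxx.
Qed.

Definition line_min (K : compactLineType d) : K := sval (cid (line_has_min K)).
Definition line_max (K : compactLineType d) : K := sval (cid (line_has_max K)).

Lemma line_minP (K : compactLineType d) (x : K) : (line_min K <= x)%O.
Proof. exact: (svalP (cid (line_has_min K))). Qed.

Lemma line_maxP (K : compactLineType d) (x : K) : (x <= line_max K)%O.
Proof. exact: (svalP (cid (line_has_max K))). Qed.

End Extremities.

Section Integral.
Context {R : realType} {d : Order.disp_t} {K : compactLineType d}.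
Implicit Types (f G : K -> R) (x t : nat -> K) (delta : K -> interval K).

(* Only [x i] for [i <= n] and [t i] for [i < n] matter; the tag of the
   subinterval [`[x i, x i.+1]] is [t i], so that tags are numbered from 0. *)
Definition is_partition (n : nat) x t : Prop :=
  [/\ x 0%N = line_min K, x n = line_max K &
      forall i, (i < n)%N -> (x i <= t i)%O /\ (t i <= x i.+1)%O].

Definition is_gauge delta : Prop :=
  forall z : K, open [set` delta z] /\ z \in delta z.

Definition is_fine delta (n : nat) x t : Prop :=
  forall i, (i < n)%N -> `]x i, x i.+1]%classic `<=` [set` delta (t i)].

Definition stieltjes_sum f G (n : nat) x t : R :=
  f (line_min K) * G (line_min K) +
  \sum_(0 <= i < n) f (t i) * (G (x i.+1) - G (x i)).

Definition has_integral f G (A : R) : Prop :=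
  forall e : R, 0 < e -> exists2 delta, is_gauge delta &
    forall (n : nat) x t, is_partition n x t -> is_fine delta n x t ->
      `|stieltjes_sum f G n x t - A| < e.

Definition G_integrable G f : Prop := exists A : R, has_integral f G A.

Definition G_integral G f : R := get (has_integral f G).

End Integral.

Section Points.
Context {d : Order.disp_t} {K : compactLineType d}.
Implicit Types x : K.

(* [line_min K] is automatically not left-dense, and [line_max K] not
   right-dense, in accordance with the usual convention. *)
Definition left_dense x : Prop :=
  forall V : set K, nbhs x V -> exists2 y, V y & (y < x)%O.

Definition right_dense x : Prop :=
  forall V : set K, nbhs x V -> exists2 y, V y & (x < y)%O.

(* The predecessor, meaningful when [x] is left-isolated and not [line_min K].*)
Definition line_pred x : K := supremum (line_min K) [set y : K | (y < x)%O].

Definition left_nbhs x : set_system K := within [set y : K | (y < x)%O] (nbhs x).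
Definition right_nbhs x : set_system K :=
  within [set y : K | (x < y)%O] (nbhs x).

End Points.

Section Regularity.
Context {R : realType} {d : Order.disp_t} {K : compactLineType d}.
Implicit Types (h : K -> R) (x : K).

Definition right_continuous h : Prop :=
  forall x, (x < line_max K)%O ->
    h @ within [set y : K | (x <= y)%O] (nbhs x) --> h x.

Definition regulated_at h x : Prop :=
  (left_dense x -> cvg (h @ left_nbhs x)) /\
  (right_dense x -> cvg (h @ right_nbhs x)).

Definition regulated h : Prop := forall x, regulated_at h x.

Definition amenable h : Prop := right_continuous h /\ regulated h.

(* Junk value when [x] is left-dense and the left-hand limit does not exist. *)
Definition left_value h x : R :=
  if x == line_min K then 0
  else if pselect (left_dense x) then lim (h @ left_nbhs x)
  else h (line_pred x).

End Regularity.

Section Differentiability.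
Context {R : realType} {d : Order.disp_t} {K : compactLineType d}.
Implicit Types (f G : K -> R) (x : K).

Definition is_G_derivative G f x (D : R) : Prop :=
  if left_value G x == G x then
    [/\ ~ left_dense x -> f x = left_value f x,
        forall V : set K, nbhs x V -> ~ exists c : R, forall y, V y -> G y = c &
        forall e : R, 0 < e -> \forall y \near x,
          `|f y - f x - D * (G y - G x)| <= e * `|G y - G x|]
  else
    regulated_at f x /\
    forall e : R, 0 < e -> \forall y \near x, (x <= y)%O ->
      `|f y - left_value f x - D * (G y - left_value G x)|
        <= e * `|G y - left_value G x|.

Definition G_differentiable G f x : Prop := exists D : R, is_G_derivative G f x D.

Definition G_derivative G f x : R := get (is_G_derivative G f x).

Lemma is_G_derivative_unique G f x (D1 D2 : R) :
  is_G_derivative G f x D1 -> is_G_derivative G f x D2 -> D1 = D2.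
Proof.
have key (u v e : R) : v != 0 -> `|u - D1 * v| <= e * `|v| ->
    `|u - D2 * v| <= e * `|v| -> `|D1 - D2| <= e + e.
  move=> v0 h1 h2; rewrite -(@ler_pM2r _ `|v|) ?normr_gt0//.
  rewrite -normrM [leRHS]mulrDl; apply: le_trans (lerD h2 h1).
  rewrite (_ : (D1 - D2) * v = (u - D2 * v) - (u - D1 * v)) ?ler_normB//.
  by rewrite mulrBl opprB [RHS]addrC addrA subrK.
suff small : is_G_derivative G f x D1 -> is_G_derivative G f x D2 ->
    forall e, 0 < e -> `|D1 - D2| <= e + e.
  move=> h1 h2; apply/eqP; rewrite -subr_eq0 -normr_le0; apply/ler_addgt0Pr.
  by move=> e e0; rewrite add0r [leRHS]splitr; apply: small; rewrite ?divr_gt0.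
rewrite /is_G_derivative; case: ifPn => [_|LG] [].
- move=> _ ncst h1 [_ _ h2] e e0; apply: contrapT => ne.
  apply: (ncst _ (filterI (h1 e e0) (h2 e e0))); exists (G x) => y [y1 y2].
  apply/eqP/negPn/negP; rewrite -subr_eq0 => Gy.
  by apply: ne; apply: key y1 y2.
- move=> _ h1 [_ h2] e e0.
  have y1 := nbhs_singleton (h1 e e0) (lexx x).
  have y2 := nbhs_singleton (h2 e e0) (lexx x).
  by apply: key y1 y2; rewrite subr_eq0 eq_sym.
Qed.

End Differentiability.

(* Main.v *)
(* Write L for the left value of G, so that G y <= L x <= G x whenever y < x, and
   dG, dL for the increments over a subinterval [u, v] tagged by t. A gauge can be
   chosen so that every such error |F v - F u - f t * dG| is at most
   eps * (dG + dL), and the sum of these bounds telescopes. At a tag where G does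
   not jump this is the straddle estimate, with dG alone. At a tag where G jumps,
   the error can be made smaller than eps times the jump, which is at most dG if
   u < t and at most dL if u = t. If the jump occurs at a left-dense point, then
   continuity of F forces the derivative 0 there, so that f is never arbitrary at
   a jump of G. What remains is 0_K and the countably many left-dense points where
   G is continuous and F is not differentiable: at the k-th of them the error is
   made smaller than eps / 2^(k+1), and each point tags at most two nondegenerate
   subintervals. Cousin's lemma makes the integral unique. *)
Require Import Defs.
From HB Require Import structures.
From mathcomp Require Import all_boot all_order all_algebra.
From mathcomp Require Import all_classical all_reals.
From mathcomp Require Import topology normedtype.
From mathcomp Require Import ring lra.

Set Implicit Arguments.
Unset Strict Implicit.
Unset Printing Implicit Defensive.

Import Order.TTheory GRing.Theory Num.Theory.
Import numFieldNormedType.Exports.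

Local Open Scope classical_set_scope.
Local Open Scope ring_scope.

(** * Order topology of a compact line, and Cousin's lemma *)

Section LineTopology.
Context {d : Order.disp_t} {K : compactLineType d}.
Implicit Types (y z p u v : K) (V : set K).

Lemma itv_convex (i : interval K) u v y :
  u \in i -> y \in i -> (u <= v)%O -> (v <= y)%O -> v \in i.
Proof.
case: i => l r; rewrite !itv_boundlr => /andP[lu _] /andP[_ yr] uv vy.
apply/andP; split.
  by apply: le_trans lu _; rewrite bnd_simp.
by apply: le_trans yr; rewrite bnd_simp.
Qed.

Lemma nbhs_open_itv (x : K) V : nbhs x V ->
  exists2 i : interval K, itv_open_ends i /\ x \in i & [set` i] `<=` V.
Proof. by rewrite itv_nbhsE. Qed.

Lemma left_isolated_near (t : K) : ~ left_dense t -> \forall y \near t, (t <= y)%O.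
Proof.
move=> nld; apply: contrapT => no; apply: nld => W tW; apply: contrapT => no'.
apply: no; apply: filterS tW => y Wy; rewrite leNgt; apply/negP => yt.
by apply: no'; exists y.
Qed.

(** By compactness the tails of [A] have a cluster point [p]. If [p] were below some [a] in [A], the
    open ray below [a] would be a neighborhood of [p] missing a tail. *)
Lemma line_has_sup (A : set K) : A !=set0 ->
  exists2 p, ubound A p & closure A p.
Proof.
move=> [a0 Aa0]; pose rays : set_system K :=
  filter_from A (fun a => A `&` `[a, +oo[%classic).
have rays_proper : ProperFilter rays.
  apply: filter_from_proper; last first.
    by move=> a Aa; exists a; split => //; rewrite /= in_itv/= lexx.
  apply: filter_from_filter; first by exists a0.
  move=> a b Aa Ab; exists (Order.max a b); first by rewrite maxEle; case: ifP.
  move=> z [Az] /=; rewrite !in_itv/= !andbT ge_max => /andP[az bz].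
  by split; split => //=; rewrite in_itv/= andbT.
have [p [_ clp]] := @line_compact d K rays rays_proper filterT.
have Ap : ubound A p.
  move=> a Aa; rewrite leNgt; apply/negP => pa.
  have [||z [[_ /=]]] := clp (A `&` `[a, +oo[%classic) `]-oo, a[%classic.
  - by exists a.
  - by apply: open_nbhs_nbhs; split; [exact: lray_open | rewrite /= in_itv].
  - by rewrite !in_itv/= andbT => /le_lt_trans h /h; rewrite ltxx.
exists p => // B pB; apply: clp => //.
by exists a0 => //; apply: subIsetl.
Qed.

(* If [p] has a successor [z], then [z] itself may have to be the tag. *)
Lemma gauge_step (delta : K -> interval K) p : is_gauge delta ->
  (p < line_max K)%O ->
  exists z s, [/\ (p < z)%O, (p <= s)%O, (s <= z)%O &
    `]p, z]%classic `<=` [set` delta s]].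
Proof.
move=> gd pmax; have [op pp] := gd p.
have [i [oi pi] isub] := nbhs_open_itv (open_nbhs_nbhs (conj op pp)).
case: i oi pi isub => l r oi pi isub.
have from z : (p < z)%O -> z \in Interval l r -> exists z s,
    [/\ (p < z)%O, (p <= s)%O, (s <= z)%O &
      `]p, z]%classic `<=` [set` delta s]].
  move=> pz zi; exists z, p; split=> //; first exact: ltW.
  move=> y /=; rewrite in_itv/= => /andP[py yz].
  by apply: isub; apply: itv_convex pi zi _ yz; exact: ltW.
case: r oi pi isub from => [b r|b] oi pi isub from; last first.
  apply: (from _ pmax); move: pi; rewrite (itv_open_ends_rinfty oi).
  rewrite !itv_boundlr => /andP[lp _]; apply/andP; split => //.
  by rewrite (le_trans lp)// bnd_simp ltW.
rewrite (itv_open_ends_rside oi) in pi isub from.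
have pr : (p < r)%O by move: pi; rewrite itv_boundlr => /andP[_]; rewrite bnd_simp.
have [[z pz zr]|no] := pselect (exists2 z, (p < z)%O & (z < r)%O).
  apply: (from z pz); move: pi; rewrite !itv_boundlr => /andP[lp _].
  by rewrite bnd_simp zr andbT (le_trans lp)// bnd_simp ltW.
exists r, r; split => //; first exact: ltW.
move=> y /=; rewrite in_itv/= => /andP[py]; rewrite le_eqVlt => /orP[/eqP ->|yr].
  by have [] := gd r.
by case: no; exists y.
Qed.

(** Cousin's lemma: the supremum of the points reachable by a fine partition is itself reachable,
    and [gauge_step] leads past it unless it is the maximum. *)
Lemma fine_partition_exists (delta : K -> interval K) : is_gauge delta ->
  exists n (x t : nat -> K), is_partition n x t /\ is_fine delta n x t.
Proof.
move=> gd.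
pose A := [set p : K | exists n (x t : nat -> K), [/\ x 0%N = line_min K, x n = p,
  forall i, (i < n)%N -> (x i <= t i)%O /\ (t i <= x i.+1)%O &
  is_fine delta n x t]].
have A_step p z s : A p -> (p <= s)%O -> (s <= z)%O ->
    `]p, z]%classic `<=` [set` delta s] -> A z.
  move=> [n [x [t [x0 xn xt fxt]]]] ps sz pz.
  exists n.+1, (fun i => if (i <= n)%N then x i else z),
    (fun i => if (i < n)%N then t i else s); split => //=.
  - by rewrite ltnn.
  - move=> i; rewrite ltnS => lein; move: (lein).
    rewrite {1}leq_eqVlt => /predU1P[->|ltin].
      by rewrite leqnn ltnn xn.
    by rewrite ltin lein; exact: xt.
  - move=> i; rewrite ltnS => lein; move: (lein).
    rewrite {1}leq_eqVlt => /predU1P[->|ltin].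
      by rewrite leqnn ltnn xn.
    by rewrite ltin lein; exact: fxt.
have A0 : A (line_min K) by exists 0%N, (fun=> line_min K), (fun=> line_min K).
have [p Ap clp] := @line_has_sup A (ex_intro _ _ A0).
have {clp} pA : A p.
  have [op pp] := gd p.
  have [y [Ay yp]] := clp _ (open_nbhs_nbhs (conj op pp)).
  (* A reachable [y] in [delta p] is joined to [p] by one subinterval tagged by [p]. *)
  apply: (A_step y p p) => //; first exact: Ap.
  move=> z /=; rewrite in_itv/= => /andP[yz zp].
  by apply: itv_convex yp pp _ zp; exact: ltW.
have [pmax|] := ltP p (line_max K).
  have [z [s [pz ps sz sub]]] := gauge_step gd pmax.
  by have := Ap z (A_step _ _ _ pA ps sz sub); rewrite leNgt pz.
move=> maxp; have pE : p = line_max K.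
  by apply/eqP; rewrite eq_le maxp line_maxP.
case: pA => n [x [t [x0 xn xt fxt]]]; exists n, x, t; split => //.
by split => //; rewrite xn.
Qed.

(* Shrinking the gauge at [t] forces both ends of any fine interval tagged by
   [t] into [V], except that the left end is the predecessor of [t] when [t] is
   left-isolated. *)
Lemma nbhs_tag (t : K) V : nbhs t V ->
  exists i : interval K, [/\ open [set` i], t \in i &
  forall u v, (u <= t)%O -> (t <= v)%O -> `]u, v]%classic `<=` [set` i] ->
    V v /\ (V u \/ [/\ ~ left_dense t, (u < t)%O &
                      forall y, (y < t)%O -> (y <= u)%O])].
Proof.
move=> tV; have Vt := nbhs_singleton tV.
have right_in (i : interval K) : [set` i] `<=` V ->
    forall u v, (u <= t)%O -> (t <= v)%O ->
    `]u, v]%classic `<=` [set` i] -> V v.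
  move=> iV u v ut tv uvi; move: tv; rewrite le_eqVlt => /predU1P[<- //|tv].
  by apply/iV/uvi; rewrite /= in_itv/= lexx andbT (le_lt_trans ut).
have [ld|nld] := pselect (left_dense t).
  have [[l r] [oi ti] iV] := nbhs_open_itv tV.
  have [a ai a_t] := ld _ (open_nbhs_nbhs (conj (itv_open_ends_open oi) ti)).
  (* Cutting at a point [a < t] of the interval forces [a <= u]: otherwise [a] would lie in []u, v]]
     but not in the interval open at [a]. *)
  exists (Interval (BRight a) r); split.
  - apply: itv_open_ends_open; case: r oi {ti iV ai} => [b r|b] oi.
      by rewrite (itv_open_ends_rside oi).
    by rewrite (itv_open_ends_rinfty oi).
  - by move: ti; rewrite !itv_boundlr bnd_simp a_t => /andP[].
  move=> u v ut tv uvi; split.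
    apply: (right_in _ _ _ _ ut tv uvi).
    move=> z /= za; apply: iV => /=; move: za ai.
    rewrite /= !itv_boundlr bnd_simp => /andP[az ->] /andP[la _].
    by rewrite andbT (le_trans la)// bnd_simp ltW.
  left; apply: iV; apply: (itv_convex ai ti _ ut).
  rewrite leNgt; apply/negP => ua.
  have /uvi : `]u, v]%classic a by rewrite /= in_itv/= ua (le_trans (ltW a_t)).
  by rewrite /= itv_boundlr bnd_simp ltxx.
(* Since [i] has no point below [t], no point lies strictly between [u] and [t]. *)
have [i [oi ti] iV] := nbhs_open_itv (filterI tV (left_isolated_near nld)).
exists i; split => //; first exact: itv_open_ends_open.
move=> u v ut tv uvi; split.
  by apply: (right_in _ _ _ _ ut tv uvi) => z /iV[].
move: ut; rewrite le_eqVlt => /predU1P[->|ut]; [by left|right; split => //].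
move=> y yt; rewrite leNgt; apply/negP => uy.
have /uvi/iV[_] : `]u, v]%classic y.
  by rewrite /= in_itv/= uy (le_trans (ltW yt)).
by rewrite /= leNgt yt.
Qed.

Lemma line_predE (t u : K) : (u < t)%O -> (forall y, (y < t)%O -> (y <= u)%O) ->
  line_pred t = u.
Proof.
move=> ut umax; apply/eqP; rewrite eq_le /line_pred.
have usup : supremums [set y : K | (y < t)%O] u.
  by split => // b; apply.
rewrite ge_supremum_Nmem//; last by exists u.
(* The default [line_min K] is returned only for an empty set, and [u] belongs to this one. *)
rewrite /supremum; case: eqP => [E|_].
  by have : [set y : K | (y < t)%O] u by []; rewrite E.
by rewrite (xget_subset1 _ usup (@is_subset1_supremums _ _ _)) lexx.
Qed.

(** An open interval around [t] with no point below [t] must have a left end, as it misses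
    [line_min K]; that end is the predecessor. *)
Lemma left_isolated_pred (t : K) : t != line_min K -> ~ left_dense t ->
  exists2 u, (u < t)%O & forall y, (y < t)%O -> (y <= u)%O.
Proof.
move=> t0 nld.
have {}t0 : (line_min K < t)%O by rewrite lt_neqAle eq_sym t0 line_minP.
have [[l r] [oi ti] iW] := nbhs_open_itv (left_isolated_near nld).
have no y : (y < t)%O -> ~~ (l <= BLeft y)%O.
  move=> yt; apply/negP => ly.
  suff /iW/= : [set` Interval l r] y by rewrite leNgt yt.
  move: ti; rewrite /= !itv_boundlr ly => /andP[_ tr] /=.
  by rewrite (le_trans _ tr)// bnd_simp ltW.
case: l oi ti iW no => [b l|b] oi ti iW no; last first.
  by have := no _ t0; rewrite (itv_open_ends_linfty oi).
rewrite (itv_open_ends_lside oi) in ti no.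
exists l; first by move: ti; rewrite itv_boundlr bnd_simp => /andP[].
by move=> y /no; rewrite bnd_simp -leNgt.
Qed.

End LineTopology.

(** * Summable weights on a countable set of tags *)

Section Weights.
Context {R : realType} {d : Order.disp_t} {K : compactLineType d}.

Lemma sum_half_powers n : \sum_(j < n) 2^-1 ^+ j.+1 = 1 - 2^-1 ^+ n :> R.
Proof.
elim: n => [|n IHn]; first by rewrite big_ord0 expr0 subrr.
by rewrite big_ord_recr/= IHn exprS; lra.
Qed.

(* A tag [c] belongs to at most two nondegenerate subintervals: one where it is
   the left end, over which the indicator of [c < y] increases, and one where it
   is not, over which the indicator of [c <= y] increases. *)
Lemma countable_tag_weight (E : set K) : countable E ->
  exists w : K -> R, (forall c, E c -> 0 < w c) /\
    forall n (x t : nat -> K), is_partition n x t ->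
      \sum_(0 <= i < n | (x i < x i.+1)%O && (t i \in E)) w (t i) <= 2.
Proof.
move=> /countable_injP[k kinj].
pose w c : R := 2^-1 ^+ (k c).+1.
have w0 j : 0 < (2^-1 : R) ^+ j.+1 by rewrite exprn_gt0// invr_gt0.
exists w; split => [c _|n x t [x0 xn xt]]; first exact: w0.
(* Indexing by numbers instead of points makes [W] below an ordinary finite sum; an index that [k]
   does not take on [E] gives the constant 0. *)
pose lt_ind j y : R := `[< exists c, [/\ E c, k c = j & (c < y)%O] >]%:R.
pose le_ind j y : R := `[< exists c, [/\ E c, k c = j & (c <= y)%O] >]%:R.
have lt_mono j : {homo lt_ind j : y z / (y <= z)%O >-> y <= z}.
  move=> y z yz; rewrite /lt_ind; case: asboolP => [[c [Ec kc cy]]|_].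
    by rewrite asboolT//; exists c; split => //; exact: lt_le_trans yz.
  by rewrite ler_nat leq0n.
have le_mono j : {homo le_ind j : y z / (y <= z)%O >-> y <= z}.
  move=> y z yz; rewrite /le_ind; case: asboolP => [[c [Ec kc cy]]|_].
    by rewrite asboolT//; exists c; split => //; exact: le_trans yz.
  by rewrite ler_nat leq0n.
have uniq_c c b : E c -> E b -> k b = k c -> b = c.
  by move=> Ec Eb kbc; apply: kinj => //; exact/mem_set.
have step c u v : E c -> (u <= c)%O -> (c <= v)%O -> (u < v)%O ->
    1 <= (lt_ind (k c) v - lt_ind (k c) u) + (le_ind (k c) v - le_ind (k c) u).
  move=> Ec uc cv uv; have ltm := lt_mono (k c) _ _ (ltW uv).
  have lem := le_mono (k c) _ _ (ltW uv).
  have [cu|uc'] := leP c u.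
    have {uc cu}cu : c = u by apply/le_anti; rewrite cu.
    suff : 1 <= lt_ind (k c) v - lt_ind (k c) u by lra.
    rewrite /lt_ind asboolT; last by exists c; split => //; rewrite cu.
    rewrite asboolF ?subr0// => -[b [Eb kb bu]].
    by move: bu; rewrite (uniq_c c b)// cu ltxx.
  suff : 1 <= le_ind (k c) v - le_ind (k c) u by lra.
  rewrite /le_ind asboolT; last by exists c.
  rewrite asboolF ?subr0// => -[b [Eb kb bu]].
  by move: bu; rewrite (uniq_c c b)// leNgt uc'.
(* [N] exceeds the index of every tag of this partition. *)
pose N := (\max_(i < n) k (t i)).+1.
pose W y := \sum_(j < N) 2^-1 ^+ j.+1 * (lt_ind j y + le_ind j y).
have dW u v : W v - W u = \sum_(j < N) 2^-1 ^+ j.+1 *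
    ((lt_ind j v - lt_ind j u) + (le_ind j v - le_ind j u)).
  by rewrite /W -sumrB; apply: eq_bigr => j _; rewrite -mulrBr; congr (_ * _); ring.
have xle i : (i < n)%N -> (x i <= x i.+1)%O by move=> /xt[]; exact: le_trans.
(* The powers of 1/2 add up to less than 1, and each of the two indicators increases by at most
   1. *)
have W2 : W (x n) - W (x 0%N) <= 2.
  rewrite dW; apply: (@le_trans _ _ (\sum_(j < N) 2^-1 ^+ j.+1 * 2)).
    apply: ler_sum => j _; apply: ler_wpM2l; first exact/ltW/w0.
    have b1 (a b : bool) : (a%:R - b%:R : R) <= 1 by case: a; case: b => /=; lra.
    by rewrite (_ : 2 = 1 + 1)//; apply: lerD; exact: b1.
  rewrite -mulr_suml sum_half_powers.
  have : 0 <= (2^-1 : R) ^+ N by rewrite exprn_ge0// invr_ge0.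
  lra.
apply: le_trans W2; rewrite -(telescope_sumr (W \o x) (leq0n n)) big_mkcond/=.
apply: ler_sum_nat => i /= ltin; have xi := xle i ltin; rewrite dW.
have nonneg (j : 'I_N) : 0 <= 2^-1 ^+ j.+1 * ((lt_ind j (x i.+1) - lt_ind j (x i)) +
    (le_ind j (x i.+1) - le_ind j (x i))).
  apply: mulr_ge0; first exact/ltW/w0.
  by apply: addr_ge0; rewrite subr_ge0; [exact: lt_mono|exact: le_mono].
case: ifPn => [/andP[xlt /set_mem Eti]|_]; last exact: sumr_ge0.
have kN : (k (t i) < N)%N.
  rewrite ltnS.
  exact: (@leq_bigmax_cond _ _ (fun i : 'I_n => k (t i)) (Ordinal ltin)).
(* By [step], the term of index [k (t i)] alone reaches the weight of the tag. *)
rewrite (bigD1 (Ordinal kN))//= -[leLHS]addr0; apply: lerD; last exact: sumr_ge0.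
apply: ler_peMr; first exact/ltW/w0.
have [? ?] := xt i ltin; exact: step.
Qed.

End Weights.

(** * The left value of a nondecreasing amenable function *)

Section LeftValue.
Context {R : realType} {d : Order.disp_t} {K : compactLineType d}.
Context (G : K -> R) (G_nondecreasing : {homo G : x y / (x <= y)%O >-> x <= y})
  (G_positive : forall x, 0 < G x) (G_amenable : amenable G).

Lemma left_dense_neq_min (t : K) : left_dense t -> t != line_min K.
Proof.
move=> ld; have [y _ yt] := ld _ filterT; apply/eqP => tE.
by move: yt; rewrite tE ltNge line_minP.
Qed.

Lemma left_nbhs_filter (t : K) : left_dense t -> ProperFilter (left_nbhs t).
Proof.
move=> ld; split; last exact: within_filter.
by move=> /ld[y Vy /Vy].
Qed.

Lemma left_valueE (t u : K) : ~ left_dense t -> (u < t)%O ->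
  (forall y, (y < t)%O -> (y <= u)%O) -> forall h : K -> R, left_value h t = h u.
Proof.
move=> nld ut umax h; rewrite /left_value; case: eqP => [tE|_].
  by move: ut; rewrite tE ltNge line_minP.
by case: pselect => // ?; rewrite (line_predE ut umax).
Qed.

Lemma left_value_lim (h : K -> R) (t : K) : left_dense t ->
  left_value h t = lim (h @ left_nbhs t).
Proof.
move=> ld; rewrite /left_value (negbTE (left_dense_neq_min ld)).
by case: pselect.
Qed.

Lemma cvg_left_value (t : K) : left_dense t -> G @ left_nbhs t --> left_value G t.
Proof.
by move=> ld; rewrite left_value_lim//; case: G_amenable => _ /(_ t)[/(_ ld)].
Qed.

Lemma le_left_value (y t : K) : (y < t)%O -> G y <= left_value G t.
Proof.
move=> yt; have t0 : t != line_min K.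
  by apply/eqP => tE; move: yt; rewrite tE ltNge line_minP.
have [ld|nld] := pselect (left_dense t); last first.
  have [u ut umax] := left_isolated_pred t0 nld.
  by rewrite (left_valueE nld ut umax); exact/G_nondecreasing/umax.
have lp := left_nbhs_filter ld; have cG := cvg_left_value ld.
rewrite -(cvg_lim (@Rhausdorff R) cG); apply: limr_ge.
  by apply/cvg_ex; exists (left_value G t).
have : nbhs t `]y, +oo[%classic.
  by apply: open_nbhs_nbhs; split; [exact: rray_open|rewrite /= in_itv/= yt].
rewrite /left_nbhs near_withinE; apply: filterS => z /=.
rewrite in_itv/= andbT => yz _.
exact/G_nondecreasing/ltW.
Qed.

Lemma left_value_le (t : K) : left_value G t <= G t.
Proof.
have [->|t0] := eqVneq t (line_min K).
  by rewrite /left_value eqxx ltW.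
have [ld|nld] := pselect (left_dense t); last first.
  have [u ut umax] := left_isolated_pred t0 nld.
  by rewrite (left_valueE nld ut umax); exact/G_nondecreasing/ltW.
have lp := left_nbhs_filter ld; have cG := cvg_left_value ld.
rewrite -(cvg_lim (@Rhausdorff R) cG); apply: limr_le.
  by apply/cvg_ex; exists (left_value G t).
rewrite /left_nbhs near_withinE; apply: filterE => z /= zt.
exact/G_nondecreasing/ltW.
Qed.

Lemma left_value_nondecreasing : {homo left_value G : x y / (x <= y)%O >-> x <= y}.
Proof.
move=> x y; rewrite le_eqVlt => /predU1P[-> //|xy].
exact: le_trans (left_value_le x) (le_left_value xy).
Qed.

(** If [u < t], then [G u <= left_value G t] puts the jump inside the increment of [G]. If [u = t],
    then [G t <= left_value G v] puts it inside the increment of the left value. *)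
Lemma left_jump_le (u t v : K) : (u <= t)%O -> (t <= v)%O -> (u < v)%O ->
  G t - left_value G t <= (G v - G u) + (left_value G v - left_value G u).
Proof.
move=> ut tv uv; have Gtv := G_nondecreasing tv.
have Luv := left_value_nondecreasing (ltW uv).
move: ut; rewrite le_eqVlt => /predU1P[utE|ut].
  by have := le_left_value uv; rewrite -utE; have := G_nondecreasing (ltW uv); lra.
by have := le_left_value ut; lra.
Qed.

Lemma near_right (t : K) (e : R) : 0 < e ->
  \forall y \near t, (t <= y)%O -> `|G y - G t| <= e.
Proof.
move=> e0; have [tmax|] := ltP t (line_max K); last first.
  move=> maxt; apply: filterE => y ty.
  rewrite (_ : y = t) ?subrr ?normr0 ?ltW//.
  by apply/le_anti; rewrite ty (le_trans (line_maxP y)).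
case: G_amenable => /(_ t tmax) /cvgrPdist_le /(_ e e0) + _.
by rewrite near_withinE; apply: filterS => y yP /yP; rewrite distrC.
Qed.

Lemma near_left_dense (t : K) (e : R) : left_dense t -> left_value G t = G t ->
  0 < e -> \forall y \near t, `|G y - G t| <= e.
Proof.
move=> ld LG e0; have cG := cvg_left_value ld.
have lp := left_nbhs_filter ld.
have := cG; rewrite LG => /cvgrPdist_le /(_ e e0).
rewrite /left_nbhs near_withinE => nl; move: (nl) (near_right t e0).
apply: filterS2 => y yl yr; have [/yr//|/yl] := leP t y.
by rewrite distrC.
Qed.

End LeftValue.

(** * Straddle estimates at a single tag *)

Section Straddle.
Context {R : realType} {d : Order.disp_t} {K : compactLineType d}.
Context (G F : K -> R) (G_nondecreasing : {homo G : x y / (x <= y)%O >-> x <= y})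
  (G_positive : forall x, 0 < G x) (G_amenable : amenable G)
  (F_continuous : continuous F).

(** The interval [i] is to become the value at [t] of a gauge. The restriction to [u < v] lets
    [left_jump_le] apply; degenerate subintervals have error 0 anyway. *)
Definition straddle (D : R) (t : K) (B : K -> K -> R) : Prop :=
  exists i : interval K, [/\ open [set` i], t \in i &
    forall u v, (u <= t)%O -> (t <= v)%O -> (u < v)%O ->
      `]u, v]%classic `<=` [set` i] ->
      `|F v - F u - D * (G v - G u)| <= B u v].

Lemma near_cont (t : K) (e : R) : 0 < e -> \forall y \near t, `|F y - F t| <= e.
Proof.
move=> e0; have /cvgrPdist_le /(_ e e0) : F @ t --> F t by exact: F_continuous.
by apply: filterS => y; rewrite distrC.
Qed.

(** The set [P] allows for control of [G] from the right only, which is what right continuity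
    provides. *)
Lemma near_increment (P : set K) (t : K) (D e : R) : 0 < e ->
  (forall e', 0 < e' -> \forall y \near t, P y -> `|G y - G t| <= e') ->
  \forall y \near t, P y -> `|F y - F t - D * (G y - G t)| <= e.
Proof.
move=> e0 nearG; have D0 : 0 < 1 + `|D| by rewrite ltr_pwDl.
have e1 : 0 < e / 2 / (1 + `|D|) by rewrite !divr_gt0.
have e2 : 0 < e / 2 by rewrite divr_gt0.
move: (nearG _ e1) (near_cont t e2); apply: filterS2 => y yG yF /yG {}yG.
rewrite (splitr e) (le_trans (ler_normB _ _))// lerD// normrM.
rewrite -[leRHS](divfK (lt0r_neq0 D0)) mulrC ler_pM//.
by rewrite lerDr.
Qed.

(** Both [F] and [G] are continuous at [t], so the error is small for any [D]; left density excludes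
    the predecessor case of [nbhs_tag]. *)
Lemma straddle_continuous (t : K) (D e : R) :
  left_dense t -> left_value G t = G t -> 0 < e ->
  straddle D t (fun _ _ => e).
Proof.
move=> ld LG e0; have e2 : 0 < e / 2 by rewrite divr_gt0.
have tV : \forall y \near t, `|F y - F t - D * (G y - G t)| <= e / 2.
  have := @near_increment setT t D _ e2; rewrite /= => nI.
  suff : \forall y \near t, True -> `|F y - F t - D * (G y - G t)| <= e / 2.
    by apply: filterS => y /(_ I).
  apply: nI => e' e'0; move: (near_left_dense G_amenable ld LG e'0).
  by apply: filterS.
have [i [oi ti iV]] := nbhs_tag tV; exists i; split => // u v ut tv uv /(iV _ _ ut tv).
move=> [vV [uV|[]//]].
rewrite (_ : F v - F u - _ =
  (F v - F t - D * (G v - G t)) - (F u - F t - D * (G u - G t))).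
  by rewrite (splitr e) (le_trans (ler_normB _ _))// lerD.
ring.
Qed.

(** A subinterval tagged by the minimum also starts there, so control from the right suffices. *)
Lemma straddle_min (D e : R) : 0 < e ->
  straddle D (line_min K) (fun _ _ => e).
Proof.
move=> e0.
have tV := near_increment D e0 (fun e' e'0 => near_right G_amenable (line_min K) e'0).
have [i [oi ti iV]] := nbhs_tag tV; exists i; split => // u v ut tv uv /(iV _ _ ut tv).
move=> [vV _]; rewrite (_ : u = line_min K); first exact: vV.
by apply/le_anti; rewrite ut line_minP.
Qed.

Lemma straddle_left_jump (t : K) (e : R) : left_dense t -> left_value G t != G t ->
  0 < e -> straddle 0 t
    (fun u v => e * ((G v - G u) + (left_value G v - left_value G u))).
Proof.
move=> ld LG e0.
have J : 0 < G t - left_value G t.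
  by rewrite subr_gt0 lt_neqAle LG left_value_le.
have eJ : 0 < e * (G t - left_value G t) / 2 by rewrite divr_gt0// mulr_gt0.
have [i [oi ti iV]] := nbhs_tag (near_cont t eJ).
exists i; split => // u v ut tv uv /(iV _ _ ut tv).
move=> [vV [uV|[]//]]; rewrite mul0r subr0.
apply: (@le_trans _ _ (e * (G t - left_value G t))).
  rewrite (_ : F v - F u = (F v - F t) - (F u - F t)); last by ring.
  by rewrite [leRHS]splitr (le_trans (ler_normB _ _))// lerD.
by rewrite ler_pM2l// left_jump_le.
Qed.

(** If [u = t], one-sided continuity makes the error small against the jump. If [u < t], then [u] is
    the predecessor, [F u] and [G u] are the left values, and the derivative estimate is already the
    one wanted. *)
Lemma straddle_left_isolated_jump (t : K) (D e : R) : t != line_min K ->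
  ~ left_dense t -> left_value G t != G t -> is_G_derivative G F t D -> 0 < e ->
  straddle D t
    (fun u v => e * ((G v - G u) + (left_value G v - left_value G u))).
Proof.
move=> t0 nld LG; rewrite /is_G_derivative (negbTE LG) => -[_ FD] e0.
have J : 0 < G t - left_value G t.
  by rewrite subr_gt0 lt_neqAle LG left_value_le.
have eJ : 0 < e * (G t - left_value G t) by rewrite mulr_gt0.
have tV := near_increment D eJ (fun e' e'0 => near_right G_amenable t e'0).
have [i [oi ti iV]] :=
  nbhs_tag (filterI (filterI tV (FD e e0)) (left_isolated_near nld)).
exists i; split => // u v ut tv uv.
move=> /(iV _ _ ut tv) [[[/(_ tv) v1 /(_ tv) v2] _] uP].
have Luv := left_value_nondecreasing G_nondecreasing G_positive G_amenable (ltW uv).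
move: ut; rewrite le_eqVlt => /predU1P[uE|ut].
  rewrite uE (le_trans v1)// ler_pM2l//.
  by apply: left_jump_le => //; rewrite -uE.
have umax : forall y, (y < t)%O -> (y <= u)%O.
  by case: uP => [[_ /=]|[]//]; rewrite leNgt ut.
move: v2; rewrite !(left_valueE nld ut umax) => /le_trans; apply.
rewrite ger0_norm ?subr_ge0 ?ler_pM2l// ?lerDl ?subr_ge0//.
exact/G_nondecreasing/ltW.
Qed.

(** The derivative estimates at [u] and [v] add up because [G u <= G t <= G v]. If [u] is the
    predecessor of [t], then [F] and [G] take the same values at both, and the part from [u] to [t]
    has no error. *)
Lemma straddle_no_jump (t : K) (D e : R) : t != line_min K ->
  left_value G t = G t -> is_G_derivative G F t D -> 0 < e ->
  straddle D t (fun u v => e * (G v - G u)).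
Proof.
move=> t0 LG; rewrite /is_G_derivative LG eqxx => -[FL _ FD] e0.
have tail u v : (u <= t)%O -> (t <= v)%O ->
    `|F v - F t - D * (G v - G t)| <= e * `|G v - G t| ->
    `|F u - F t - D * (G u - G t)| <= e * `|G u - G t| ->
    `|F v - F u - D * (G v - G u)| <= e * (G v - G u).
  move=> /G_nondecreasing ut /G_nondecreasing tv.
  rewrite [`|G v - _|]ger0_norm ?subr_ge0// [`|G u - _|]ler0_norm ?subr_le0//.
  move=> hv hu.
  rewrite (_ : F v - F u - _ =
    (F v - F t - D * (G v - G t)) - (F u - F t - D * (G u - G t))); last by ring.
  by rewrite (le_trans (ler_normB _ _))// (le_trans (lerD hv hu))//; lra.
have [i [oi ti iV]] := nbhs_tag (FD e e0).
exists i; split => // u v ut tv uv /(iV _ _ ut tv) [vV [uV|]]; first exact: tail.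
move=> [nld ut' umax]; apply: tail => //.
rewrite -(left_valueE nld ut' umax F) -(left_valueE nld ut' umax G) -FL// LG.
by rewrite !subrr mulr0 subrr normr0 mulr0.
Qed.

(** The left value of [F] is [F t], and to the right of [t] the difference [G y - left_value G t] is
    at least the jump, against which [F y - F t] is negligible. *)
Lemma left_jump_derivative (t : K) : left_dense t -> left_value G t != G t ->
  is_G_derivative G F t 0.
Proof.
move=> ld LG; rewrite /is_G_derivative (negbTE LG).
have lp := left_nbhs_filter ld.
have Fl : F @ left_nbhs t --> F t by apply: cvg_within_filter; exact: F_continuous.
have Fr : F @ right_nbhs t --> F t by apply: cvg_within_filter; exact: F_continuous.
split; first by split=> _; apply/cvg_ex; exists (F t).
rewrite left_value_lim// (cvg_lim _ Fl)// => e e0.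
have J : 0 < G t - left_value G t.
  by rewrite subr_gt0 lt_neqAle LG left_value_le.
have eJ : 0 < e * (G t - left_value G t) by rewrite mulr_gt0.
move: (near_cont t eJ); apply: filterS => y yF ty.
rewrite mul0r subr0 (le_trans yF)// ler_pM2l// ler_normr lerD2r.
by rewrite G_nondecreasing.
Qed.

End Straddle.

(** * Uniqueness of the integral *)

Section Uniqueness.
Context {R : realType} {d : Order.disp_t} {K : compactLineType d}.

(** A partition fine for the intersection of two gauges has a sum close to both values. *)
Lemma has_integral_unique (f G : K -> R) (A B : R) :
  has_integral f G A -> has_integral f G B -> A = B.
Proof.
move=> hA hB; apply/eqP; rewrite -subr_eq0 -normr_le0; apply/ler_addgt0Pr => e e0.
have e2 : 0 < e / 2 by rewrite divr_gt0.
have [dA gA sA] := hA _ e2; have [dB gB sB] := hB _ e2.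
have [n [x [t [pxt fxt]]]] : exists n (x t : nat -> K),
    is_partition n x t /\ is_fine (fun z => (dA z `&` dB z)%O) n x t.
  apply: fine_partition_exists => z; have [oA zA] := gA z; have [oB zB] := gB z.
  by split; [rewrite set_itvI; exact: openI|rewrite in_itvI zA].
have fA : is_fine dA n x t by move=> i /fxt; rewrite set_itvI subsetI => -[].
have fB : is_fine dB n x t by move=> i /fxt; rewrite set_itvI subsetI => -[].
have := sA n x t pxt fA; have := sB n x t pxt fB.
set S := stieltjes_sum _ _ _ _ _ => hSB hSA.
rewrite add0r (_ : A - B = (S - B) - (S - A)); last by ring.
by rewrite (le_trans (ler_normB _ _))// [leRHS]splitr lerD// ltW.
Qed.

End Uniqueness.

(** * Assembling the local estimates into a gauge *)

Theorem theorem4p7 (R : realType) (d : Order.disp_t) (K : compactLineType d)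
  (G F f : K -> R) (C : set K)
  (G_nondecreasing : {homo G : x y / (x <= y)%O >-> x <= y})
  (G_positive : forall x, 0 < G x)
  (G_amenable : amenable G)
  (F_continuous : continuous F)
  (C_countable : countable C)
  (C_left_dense : forall x, C x -> left_dense x)
  (F_differentiable :
     forall x, x != line_min K -> ~ C x -> G_differentiable G F x)
  (f_derivative :
     forall x, G_differentiable G F x -> f x = G_derivative G F x) :
  G_integrable G f /\
  G_integral G f =
    F (line_max K) - (F (line_min K) - f (line_min K) * G (line_min K)).
Proof.
set A := F (line_max K) - _.
suff fA : has_integral f G A.
  have fint : G_integrable G f by exists A.
  split => //; apply: (has_integral_unique _ fA).
  exact: (getPex fint).
have fD t D : is_G_derivative G F t D -> f t = D.
  move=> FD; have Ft : G_differentiable G F t by exists D.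
  by rewrite f_derivative//; apply: is_G_derivative_unique FD; exact: (getPex Ft).
have fdiff t : t != line_min K -> ~ C t -> is_G_derivative G F t (f t).
  by move=> t0 /(F_differentiable t t0)[D FD]; rewrite (fD _ _ FD).
pose E := C `|` [set line_min K].
have [w [w0 w_sum]] : exists w : K -> R, (forall c, E c -> 0 < w c) /\
    forall n (x t : nat -> K), is_partition n x t ->
      \sum_(0 <= i < n | (x i < x i.+1)%O && (t i \in E)) w (t i) <= 2.
  apply: countable_tag_weight; rewrite /E -bigcup2E; apply: bigcup_countable => //.
  by move=> [|[|i]] _ //=; rewrite /bigcup2/=.
pose L := left_value G.
have L_nondecreasing : {homo L : x y / (x <= y)%O >-> x <= y}.
  exact: left_value_nondecreasing.
have variation0 u v : (u < v)%O -> 0 <= (G v - G u) + (L v - L u).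
  move=> /ltW uv; rewrite addr_ge0// subr_ge0.
    exact: G_nondecreasing.
  exact: L_nondecreasing.
(* One form of bound serves all tags, so that its three summands can be added over a partition
   separately. *)
pose bound e t u v :=
  e * ((G v - G u) + (L v - L u) + (if t \in E then w t else 0)).
have tags e t : 0 < e -> straddle G F (f t) t (bound e t).
  move=> e0; have wt : 0 <= (if t \in E then w t else 0).
    by case: ifPn => // /set_mem /w0 /ltW.
  have weaken B : straddle G F (f t) t B -> (forall u v, (u < v)%O ->
      B u v <= bound e t u v) -> straddle G F (f t) t (bound e t).
    move=> [i [oi ti iB]] BB; exists i; split => // u v ut tv uv uvi.
    exact: le_trans (iB _ _ ut tv uv uvi) (BB _ _ uv).
  have exceptional : E t -> forall u v, (u < v)%O ->
      e * w t <= bound e t u v.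
    by move=> Et u v /variation0 uv; rewrite /bound ler_pM2l// mem_set// lerDr.
  have ewt : E t -> 0 < e * w t by move=> Et; rewrite mulr_gt0// w0.
  have jump u v : (u < v)%O -> e * ((G v - G u) + (L v - L u)) <=
      bound e t u v.
    by move=> _; rewrite /bound ler_pM2l// lerDl.
  have [t0|t0] := eqVneq t (line_min K).
    have Et : E t by right.
    apply: weaken (exceptional Et); rewrite [in straddle _ _ _ t]t0.
    by apply: straddle_min => //; exact: ewt.
  have [LG|LG] := eqVneq (L t) (G t).
    have [Ct|nCt] := pselect (C t).
      have Et : E t by left.
      apply: weaken (exceptional Et).
      by apply: straddle_continuous => //; [exact: C_left_dense|exact: ewt].
    apply: (weaken (fun u v => e * (G v - G u))).
      by apply: straddle_no_jump => //; exact: fdiff.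
    move=> u v uv; rewrite /bound ler_pM2l// -addrA lerDl addr_ge0// subr_ge0.
    exact/L_nondecreasing/ltW.
  have [ld|nld] := pselect (left_dense t).
    (* Here [t] may belong to [C]; its derivative 0 still determines [f t]. *)
    apply: weaken jump; rewrite (fD t 0); first exact: straddle_left_jump.
    exact: left_jump_derivative.
  apply: weaken jump; apply: straddle_left_isolated_jump => //.
  by apply: fdiff => // /C_left_dense.
move=> e e0.
(* The total increments of [G] and [L], plus the 2 of [w_sum]. *)
pose M := (G (line_max K) - G (line_min K)) + (L (line_max K) - L (line_min K)) + 2.
have M0 : 0 < M.
  rewrite ltr_wpDl// addr_ge0// subr_ge0.
    exact/G_nondecreasing/line_minP.
  exact/L_nondecreasing/line_minP.
(* The errors then add up to at most [e / 2], which gives the strict inequality. *)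
pose a := e / 2 / M; have a0 : 0 < a by rewrite !divr_gt0.
pose delta t := projT1 (cid (tags a t a0)).
exists delta => [z|n x t pxt fxt].
  by rewrite /delta; case: cid => i [].
have [x0 xn xt] := pxt.
have -> : stieltjes_sum f G n x t - A = \sum_(0 <= i < n)
    (f (t i) * (G (x i.+1) - G (x i)) - (F (x i.+1) - F (x i))).
  rewrite sumrB (telescope_sumr (F \o x))//= x0 xn /stieltjes_sum /A; ring.
apply: (@le_lt_trans _ _ (a * M)); last first.
  by rewrite /a divfK ?lt0r_neq0// ltr_pdivrMr// ltr_pMr// ltr1n.
apply: le_trans (ler_norm_sum _ _ _) _.
apply: (@le_trans _ _ (\sum_(0 <= i < n) a * (
    (G (x i.+1) - G (x i)) + (L (x i.+1) - L (x i)) +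
    (if (x i < x i.+1)%O && (t i \in E) then w (t i) else 0)))).
  apply: ler_sum_nat => i /= ltin; have [xti tix] := xt i ltin.
  (* A degenerate subinterval has error 0 and is charged no weight. *)
  have := le_trans xti tix; rewrite le_eqVlt => /predU1P[xE|xlt].
    by rewrite -xE !subrr mulr0 subrr normr0 ltxx/= !addr0 mulr0.
  rewrite xlt/= distrC; have := fxt i ltin; rewrite /delta.
  by case: cid => j /= [_ _ jP] /(jP _ _ xti tix xlt).
rewrite -mulr_sumr ler_pM2l// 2!big_split/= -big_mkcond/=.
rewrite (telescope_sumr (G \o x))// (telescope_sumr (L \o x))//= x0 xn.
by rewrite lerD2l; exact: w_sum.
Qed.
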